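(* Let $T$ be a (possibly unbounded) quasinormal operator in a complex Hilbert space $H$ such that $T^n$ is normal for some integer $n\geq 2$. Then $T$ is normal.
   Context: Operators are linear and not necessarily bounded. Products and powers are defined on natural domains: $D(ST)=\{x\in D(T):Tx\in D(S)\}$. A densely defined operator $S$ is normal if it is closed and $SS^*=S^*S$ (equality including domains). An operator $S$ is quasinormal if it is closed, densely defined and $SS^*S=S^*S^2$ (equality including domains). *)

(* Defs.v *)
From HB Require Import structures.
From mathcomp Require Import all_boot all_order all_algebra.
From mathcomp Require Import boolp classical_sets reals topology normedtype.
From mathcomp Require Import complex.

Set Implicit Arguments.
Unset Strict Implicit.
Unset Printing Implicit Defensive.

Import Order.TTheory GRing.Theory Num.Theory.
Import numFieldNormedType.Exports.

Local Open Scope classical_set_scope.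
Local Open Scope ring_scope.
Local Open Scope complex_scope.

(* Complex Hilbert spaces: complete normed spaces over [R[i]] whose norm comes
   from an inner product, linear in its first argument and conjugate-linear in
   its second. *)
HB.mixin Record NormedModule_hasInner (R : realType) H
    of CompleteNormedModule R[i] H := {
  inner : {dot H for @Num.conj R[i]} ;
  innerE : forall x : H, inner x x = `|x| ^+ 2
}.

#[short(type="hilbertType")]
HB.structure Definition Hilbert (R : realType) :=
  { H of CompleteNormedModule R[i] H & NormedModule_hasInner R H }.

(* [app] is total; its values outside [dom] are irrelevant (see [op_eq]). *)
Record operator (R : realType) (H : hilbertType R) := Operator {
  dom : set H ;
  app :> H -> H ;
  dom0 : dom 0 ;
  domP : forall (a : R[i]) (x y : H), dom x -> dom y -> dom (a *: x + y) ;
  appP : forall (a : R[i]) (x y : H), dom x -> dom y ->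
    app (a *: x + y) = a *: app x + app y
}.

Section Operators.
Variables (R : realType) (H : hilbertType R).
Implicit Types (S T : operator H).

Definition op_eq S T := dom S = dom T /\ (forall x, dom S x -> S x = T x).

Definition op_id : operator H.
Proof. by exists setT id. Defined.

Definition op_comp S T : operator H.
Proof.
exists [set x | dom T x /\ dom S (T x)] (fun x => S (T x)).
- split; first exact: dom0.
  have := appP (-1) (dom0 T) (dom0 T).
  by rewrite scaler0 addr0 scaleN1r addNr => ->; exact: dom0.
- move=> a x y [Tx STx] [Ty STy]; split; first exact: domP.
  by rewrite appP //; exact: domP.
- by move=> a x y [Tx STx] [Ty STy]; rewrite !appP.
Defined.

Definition op_pow T n : operator H := iter n (op_comp T) op_id.

Definition densely_defined T := dense (dom T).

Definition closed_op T := closed [set p : H * H | dom T p.1 /\ p.2 = T p.1].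

Definition adjoint_rel T (y z : H) :=
  forall x, dom T x -> inner (T x) y = inner x z.

Lemma adjoint_rel_lin T (a : R[i]) y y' z z' : adjoint_rel T y z ->
  adjoint_rel T y' z' -> adjoint_rel T (a *: y + y') (a *: z + z').
Proof.
by move=> yz yz' x Tx; rewrite !linearPr /= yz // yz'.
Qed.

Lemma dense_orthogonal0 (D : set H) (w : H) :
  dense D -> (forall x, D x -> inner x w = 0) -> w = 0.
Proof.
move=> dD w0; apply/eqP; apply: contrapT => /negP wn0.
have w_gt0 : 0 < `|w| by rewrite normr_gt0.
have [|x [wx Dx]] := dD _ _ (ball_open w `|w|).
  by exists w; exact: ballxx.
have xw : inner w x = 0 by rewrite hermC /= (w0 _ Dx) rmorph0 mulr0.
move: wx; rewrite -ball_normE /= => wx.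
suff wle : `|w| <= `|w - x| by have := lt_le_trans wx wle; rewrite ltxx.
rewrite -ler_sqr ?nnegrE // -!innerE.
rewrite linearBl /= !linearBr /= (w0 _ Dx) xw sub0r subr0 opprK.
by rewrite lerDl innerE exprn_ge0.
Qed.

Lemma adjoint_rel_uniq T y z z' : densely_defined T ->
  adjoint_rel T y z -> adjoint_rel T y z' -> z = z'.
Proof.
move=> dT yz yz'; apply/eqP; rewrite -subr_eq0; apply/eqP.
apply: (dense_orthogonal0 dT) => x Tx.
by rewrite linearBr /= -yz // -yz' // subrr.
Qed.

(* The adjoint is only meaningful for densely defined [T]: for these, the [z]
   with [adjoint_rel T y z] is unique.  Otherwise its value is set to 0. *)
Definition adjoint_app T (y : H) : H :=
  if `[< densely_defined T >] then xget 0 (adjoint_rel T y) else 0.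

Lemma adjoint_appE T y z : densely_defined T ->
  adjoint_rel T y z -> adjoint_app T y = z.
Proof.
move=> dT yz; rewrite /adjoint_app asboolT //.
by apply: (adjoint_rel_uniq dT _ yz); exact: (xgetI _ yz).
Qed.

Definition adjoint T : operator H.
Proof.
exists [set y | exists z, adjoint_rel T y z] (adjoint_app T).
- by exists 0 => x _; rewrite !linear0r.
- by move=> a y y' [z yz] [z' yz']; exists (a *: z + z'); exact: adjoint_rel_lin.
- move=> a y y' [z yz] [z' yz'].
  have [dT|ndT] := pselect (densely_defined T).
    rewrite (adjoint_appE dT yz) (adjoint_appE dT yz').
    by apply: adjoint_appE => //; exact: adjoint_rel_lin.
  by rewrite /adjoint_app asboolF // scaler0 addr0.
Defined.

Lemma adjointP T x y : densely_defined T -> dom T x -> dom (adjoint T) y ->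
  inner (T x) y = inner x (adjoint T y).
Proof. by move=> dT Tx [z yz]; rewrite /= (adjoint_appE dT yz) yz. Qed.

Definition normal_op S :=
  [/\ densely_defined S, closed_op S &
      op_eq (op_comp S (adjoint S)) (op_comp (adjoint S) S)].

Definition quasinormal_op S :=
  [/\ densely_defined S, closed_op S &
      op_eq (op_comp S (op_comp (adjoint S) S))
            (op_comp (adjoint S) (op_pow S 2))].

End Operators.

(* Main.v *)
(* Let A and B be the inverses of 1 + T*T and 1 + TT*; they are everywhere
   defined, by orthogonal projection onto the graph of T, and symmetric.  Always
   T A extends B T, and quasinormality gives T A = A T on D(T), so A and B agree
   on the range of T; by symmetry, A - B has its range in ker T*.  If ker T* is
   contained in ker T, then A and B both fix ker T*, whence for u = A w - B w
   one gets <u, u> = <w, A u - B u> = 0.  So A = B, that is T*T = TT*.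
   The inclusion of kernels comes from N = T^n: ker T* is contained in ker N*,
   which is ker N as N is normal, and ker N = ker T as T is quasinormal. *)
Require Import Defs.
From mathcomp Require Import all_boot reals.
From mathcomp Require Import all_order all_algebra.
From mathcomp Require Import boolp classical_sets interval_inference.
From mathcomp Require Import topology normedtype complex.
From mathcomp Require Import ring lra.

Set Implicit Arguments.
Unset Strict Implicit.
Unset Printing Implicit Defensive.

Import Order.TTheory GRing.Theory Num.Theory.
Import numFieldNormedType.Exports.

Local Open Scope classical_set_scope.
Local Open Scope ring_scope.

(** * The inner product of the Hilbert sum of two copies of [H] *)

Section InnerProduct.
Variables (R : realType) (H : hilbertType R).
Implicit Types (x y z : H) (p q v : H * H) (a : R[i]).

Lemma innerC x y : inner x y = (inner y x)^*.
Proof. by rewrite hermC /= expr0 mul1r. Qed.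

Lemma inner_eq0 x : inner x x = 0 -> x = 0.
Proof. by rewrite innerE => /eqP; rewrite sqrf_eq0 normr_eq0 => /eqP. Qed.

(* The norm that [H * H] carries in the library is the maximum norm, which does
   not come from an inner product; this is the inner product of the Hilbert sum. *)
Definition pinner p q := inner p.1 q.1 + inner p.2 q.2.

Lemma pinnerC p q : pinner p q = (pinner q p)^*.
Proof. by rewrite /pinner rmorphD /= -!innerC. Qed.

Lemma pinnerDl p q v : pinner (p + q) v = pinner p v + pinner q v.
Proof. by rewrite /pinner !linearDl addrACA. Qed.

Lemma pinnerZl a p v : pinner (a *: p) v = a * pinner p v.
Proof. by rewrite /pinner !linearZl_LR mulrDr. Qed.

Lemma pinnerDr p q v : pinner v (p + q) = pinner v p + pinner v q.
Proof. by rewrite pinnerC pinnerDl rmorphD /= -!pinnerC. Qed.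

Lemma pinnerZr a p v : pinner v (a *: p) = a^* * pinner v p.
Proof. by rewrite pinnerC pinnerZl rmorphM /= -pinnerC. Qed.

Lemma pinnerE p : pinner p p = `|p.1| ^+ 2 + `|p.2| ^+ 2.
Proof. by rewrite /pinner !innerE. Qed.

Lemma pinner_ge0 p : 0 <= pinner p p.
Proof. by rewrite pinnerE addr_ge0 ?exprn_ge0. Qed.

Lemma pinner_expand a p q : pinner (p + a *: q) (p + a *: q) =
  pinner p p + a^* * pinner p q + a * (pinner p q)^* + a * a^* * pinner q q.
Proof.
rewrite !(pinnerDl, pinnerDr, pinnerZl, pinnerZr) (pinnerC q p); ring.
Qed.

Lemma pinner_parallelogram p q :
  pinner (p - q) (p - q) + pinner (p + q) (p + q) =
  (pinner p p + pinner q q) *+ 2.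
Proof.
rewrite -[q in X in _ + X]scale1r -[- q]scaleN1r !pinner_expand.
by rewrite !rmorphN !rmorph1; ring.
Qed.

(** With [c = pinner p v] and [q = pinner v v], moving [p] by [- (s * c) *: v] changes its squared
    norm by [s * |c|^2 * (s * q - 2)], which is negative for small [s > 0] unless [c = 0]. *)
Lemma pinner_min_orthogonal p v :
  (forall a, pinner p p <= pinner (p + a *: v) (p + a *: v)) -> pinner p v = 0.
Proof.
move=> pmin; apply/eqP; apply: contraT => c0.
have q0 := pinner_ge0 v.
set c := pinner p v in c0 *; set q := pinner v v in q0.
have cc : 0 < c * c^* by rewrite -normCK exprn_gt0 // normr_gt0.
(* The summand 1 keeps [s] positive even if [q = 0] and gives [s * q < 1]. *)
set s := (1 + q)^-1.
have s0 : 0 < s by rewrite invr_gt0 ltr_pwDl.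
have sR : s^* = s by apply/CrealP/gtr0_real.
have := pmin (- (s * c)).
rewrite pinner_expand rmorphN rmorphM /= sR -/c -/q.
have -> : pinner p p + - (s * c^*) * c + - (s * c) * c^* +
    - (s * c) * - (s * c^*) * q =
    pinner p p + (s * (c * c^*)) * (s * q - 2) by ring.
rewrite lerDl pmulr_rge0; last exact: mulr_gt0.
rewrite subr_ge0.
have : s * q < 1 by rewrite mulrC ltr_pdivrMr ?ltr_pwDl // mul1r ltrDr.
by move=> sq1; rewrite lt_geF // (lt_trans sq1) // ltr1n.
Qed.

End InnerProduct.

(** * Orthogonal projection onto a closed subspace *)

Section Projection.
Variables (R : realType) (H : hilbertType R).

(** A minimizing sequence for the distance from [p] to [G] converges to a nearest point, and
    minimality makes the residual orthogonal to [G]. *)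
Lemma closed_projection (G : set (H * H)) (p : H * H) :
  closed G -> G 0 -> (forall (a : R[i]) u v, G u -> G v -> G (a *: u + v)) ->
  exists2 g, G g & forall v, G v -> pinner (p - g) v = 0.
Proof.
move=> clG G0 Glin.
pose f u := pinner (p - u) (p - u).
have f0 u : 0 <= f u by exact: pinner_ge0.
(* The order of [R[i]] is partial, so the infimum is taken in [R], over real parts. *)
have fRe u : f u = (complex.Re (f u))%:C%C by rewrite RRe_real // ger0_real.
pose E := [set complex.Re (f u) | u in G].
have hE : has_inf E.
  split; first by exists (complex.Re (f 0)), 0.
  by exists 0 => _ [u _ <-]; rewrite -lecR -fRe.
set d := inf E.
have d_le u : G u -> d%:C%C <= f u.
  by move=> Gu; rewrite fRe lecR; apply: ge_inf; [case: hE|exists u].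
have /choice [u uP] (k : nat) : exists u, G u /\ f u < (d + k.+1%:R^-1)%:C%C.
  have [|_ [u Gu <-] ud] := @inf_adherent _ E k.+1%:R^-1 _ hE.
    by rewrite invr_gt0.
  by exists u; split => //; rewrite fRe ltcR.
(* The midpoint [h] lies in [G], so [f h >= d], and the parallelogram identity bounds the left side
   by [2 * (1/(k+1) + 1/(l+1))]. *)
have u_cauchy k l : (k <= l)%N ->
    pinner (u k - u l) (u k - u l) <= (4 * k.+1%:R^-1)%:C%C.
  move=> kl; set h := 2^-1 *: (u k + u l).
  have Gh : G h.
    rewrite /h scalerDr; apply: (Glin); first by case: (uP k).
    by rewrite -[_ *: _]addr0; apply: (Glin) => //; case: (uP l).
  have := pinner_parallelogram (p - u l) (p - u k).
  have -> : p - u l - (p - u k) = u k - u l by rewrite opprB addrC addrA subrK.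
  have -> : p - u l + (p - u k) = 2 *: (p - h).
    rewrite scalerBr scalerA divff ?pnatr_eq0 // scale1r scaler_nat mulr2n.
    by rewrite addrACA -opprD [u k + _]addrC.
  rewrite pinnerZl pinnerZr rmorph_nat -!/(f _) => /(canRL (addrK _)) ->.
  have := d_le _ Gh; have [_] := uP k; have [_] := uP l.
  rewrite (fRe h) (fRe (u k)) (fRe (u l)) !ltcR lecR => ul uk dh.
  have -> x y z : (x%:C%C + y%:C%C) *+ 2 - 2 * (2 * z%:C%C) =
      ((x + y) *+ 2 - 2 * (2 * z))%:C%C :> R[i].
    by rewrite rmorphB rmorphMn rmorphD !rmorphM rmorph_nat.
  have : l.+1%:R^-1 <= k.+1%:R^-1 :> R by rewrite lef_pV2 ?posrE // ler_nat.
  move: ul uk; set i := l.+1%:R^-1; set j := k.+1%:R^-1 => ul uk kl'.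
  rewrite lecR; lra.
have natSinv_lt (e : R[i]) : 0 < e -> exists N, (N.+1%:R^-1)%:C%C < e.
  move=> e0.
  have eRe : e = (complex.Re e)%:C%C by rewrite RRe_real // gtr0_real.
  have e0' : 0 < complex.Re e by rewrite -ltcR -eRe.
  have [N _ NP] := near_infty_natSinv_lt (PosNum e0').
  by exists N; rewrite eRe ltcR; exact: (NP N (leqnn N)).
(* Completeness of [H] is applied to each coordinate; [pr] stands for either one. *)
have u_cvg (pr : H * H -> H) :
    (forall v w, `|pr v - pr w| ^+ 2 <= pinner (v - w) (v - w)) ->
    cvg (pr (u k) @[k --> \oo]).
  move=> prP; apply: cauchy_cvg; apply: cauchy_exP => e e0.
  have [N Ne] := natSinv_lt _ (divr_gt0 (exprn_gt0 2 e0) (ltr0n _ 4)).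
  exists (pr (u N)); exists N => // k Nk; rewrite -ball_normE /=.
  rewrite -ltr_sqr ?nnegrE ?(ltW e0) //.
  apply: le_lt_trans (prP _ _) (le_lt_trans (u_cauchy _ _ Nk) _).
  by rewrite rmorphM rmorph_nat mulrC -ltr_pdivlMr.
have /cvg_ex[g1 ug1] : cvg ((u k).1 @[k --> \oo]).
  by apply: (u_cvg) => v w; rewrite pinnerE lerDl exprn_ge0.
have /cvg_ex[g2 ug2] : cvg ((u k).2 @[k --> \oo]).
  by apply: (u_cvg) => v w; rewrite pinnerE lerDr exprn_ge0.
pose g := (g1, g2).
have ug : u k @[k --> \oo] --> g.
  have -> : u = fun k => ((u k).1, (u k).2) by apply/funext => k; case: (u k).
  exact: cvg_pair.
have Gg : G g.
  by refine (closed_cvg G clG _ g ug); apply: nearW => k; case: (uP k).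
have fug : f (u k) @[k --> \oo] --> f g.
  have fE w : f w = `|p.1 - w.1| * `|p.1 - w.1| + `|p.2 - w.2| * `|p.2 - w.2|.
    by rewrite /f pinnerE.
  under eq_fun do rewrite fE; rewrite fE.
  by apply: cvgD; apply: cvgM; apply: cvg_norm; apply: cvgB => //;
    exact: cvg_cst.
(* Otherwise [f (u k)] would eventually exceed [d + 1/(N+1)] for some [N], against the choice of
   [u k] for [k >= N]. *)
have fg : f g <= d%:C%C.
  rewrite fRe lecR leNgt; apply/negP; rewrite -subr_gt0 => dg.
  have [|N Ne] := natSinv_lt (complex.Re (f g) - d)%:C%C; first by rewrite ltcR.
  have : (d + N.+1%:R^-1)%:C%C < `|f g|.
    rewrite ger0_norm // fRe ltcR; by move: Ne; rewrite ltcR ltrBrDl.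
  move=> /(cvgr_norm_gt _ fug) [M _ MP].
  have := MP (maxn M N) (leq_maxl _ _); rewrite ger0_norm //.
  have [_ h] := uP (maxn M N) => /lt_trans /(_ h).
  rewrite ltcR ltrD2l ltf_pV2 ?posrE // ltr_nat ltnS ltnNge.
  by rewrite leq_maxr.
exists g => // v Gv; apply: (pinner_min_orthogonal (p := p - g)) => a.
apply: le_trans fg _.
have -> : p - g + a *: v = p - (- a *: v + g).
  by rewrite opprD scaleNr opprK addrA addrAC.
by apply: d_le; exact: Glin.

Qed.

End Projection.

(** * Surjectivity and symmetry of [1 + T*T] and [1 + TT*] *)

Section Operators.
Variables (R : realType) (H : hilbertType R) (T : operator H).
Hypothesis (dT : densely_defined T) (cT : closed_op T).

Lemma adjointI y z : adjoint_rel T y z -> dom (adjoint T) y /\ adjoint T y = z.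
Proof. by move=> yz; split; [exists z|exact: adjoint_appE]. Qed.

Lemma app0 : T 0 = 0.
Proof.
by have := Defs.appP (-1) (dom0 T) (dom0 T); rewrite !scaleN1r !addNr.
Qed.

Lemma graph_projection a b : exists2 y, dom T y &
  forall v, dom T v -> inner (a - y) v + inner (b - T y) (T v) = 0.
Proof.
have [||g [Tg g2] gP] := closed_projection (a, b) cT.
- by split; [exact: dom0|rewrite app0].
- by move=> c [u1 u2] [v1 v2] [/= Tu ->] [/= Tv ->]; split => /=;
    [exact: domP|rewrite Defs.appP].
exists g.1 => // v Tv; have := gP (v, T v) (conj Tv erefl).
by rewrite /pinner /= g2.
Qed.

(** Projecting [(w, 0)] onto the graph of [T] leaves the residual [(w - a, - T a)]; its
    orthogonality to the graph says [adjoint T (T a) = w - a]. *)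
Lemma adjoint_comp_surj w : exists a,
  [/\ dom T a, dom (adjoint T) (T a) & a + adjoint T (T a) = w].
Proof.
have [a Ta aP] := graph_projection w 0.
have [Da Ea] : dom (adjoint T) (T a) /\ adjoint T (T a) = w - a.
  apply: adjointI => v Tv; have := aP v Tv.
  rewrite sub0r linearNl => /subr0_eq e.
  by rewrite innerC -e -innerC.
by exists a; rewrite Ea addrC subrK.
Qed.

(** Projecting [(0, w)] leaves the residual [(- y, b)] with [b = w - T y], and orthogonality says
    [adjoint T b = y]. *)
Lemma comp_adjoint_surj w : exists b,
  [/\ dom (adjoint T) b, dom T (adjoint T b) & b + T (adjoint T b) = w].
Proof.
have [y Ty yP] := graph_projection 0 w.
have [Db Eb] : dom (adjoint T) (w - T y) /\ adjoint T (w - T y) = y.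
  apply: adjointI => v Tv; have := yP v Tv.
  rewrite sub0r linearNl addrC => /subr0_eq e.
  by rewrite innerC e -innerC.
by exists (w - T y); rewrite Eb subrK.
Qed.

Lemma adjointPC x y : dom T x -> dom (adjoint T) y ->
  inner y (T x) = inner (adjoint T y) x.
Proof. by move=> Tx Ty; rewrite innerC adjointP // -innerC. Qed.

Lemma adjoint_comp_sym x y : dom T x -> dom (adjoint T) (T x) ->
  dom T y -> dom (adjoint T) (T y) ->
  inner (x + adjoint T (T x)) y = inner x (y + adjoint T (T y)).
Proof.
move=> Tx TTx Ty TTy; rewrite linearDl linearDr /=.
by rewrite -adjointPC // -adjointP.
Qed.

Lemma comp_adjoint_sym x y : dom (adjoint T) x -> dom T (adjoint T x) ->
  dom (adjoint T) y -> dom T (adjoint T y) ->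
  inner (x + T (adjoint T x)) y = inner x (y + T (adjoint T y)).
Proof.
move=> Tx TTx Ty TTy; rewrite linearDl linearDr /=.
by rewrite adjointPC // adjointP.
Qed.

Lemma ker_adjoint y : (forall x, dom T x -> inner (T x) y = 0) ->
  dom (adjoint T) y /\ adjoint T y = 0.
Proof. by move=> yP; apply: adjointI => x Tx; rewrite yP // linear0r. Qed.

Lemma ker_adjoint_comp x : dom T x -> dom (adjoint T) (T x) ->
  adjoint T (T x) = 0 -> T x = 0.
Proof.
by move=> Tx DTx E; apply: inner_eq0; rewrite adjointP // E linear0r.
Qed.

End Operators.

(** * Kernels and resolvents of quasinormal operators *)

Section Quasinormal.
Variables (R : realType) (H : hilbertType R) (T : operator H).
Hypothesis (qT : quasinormal_op T).

Let dT : densely_defined T. Proof. by case: qT. Qed.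
Let cT : closed_op T. Proof. by case: qT. Qed.

Lemma quasinormal_commute x : dom T x -> dom (adjoint T) (T x) ->
  dom T (adjoint T (T x)) -> [/\ dom T (T x), dom (adjoint T) (T (T x)) &
    T (adjoint T (T x)) = adjoint T (T (T x))].
Proof.
case: qT => _ _ [dE E] Tx DTx TDTx.
have D : dom (op_comp T (op_comp (adjoint T) T)) x by [].
have := E _ D; move: D; rewrite dE => -[[_ TTx] DTTx] /= e.
by split.
Qed.

Lemma quasinormal_commute_rev x : dom T x -> dom T (T x) ->
  dom (adjoint T) (T (T x)) -> [/\ dom (adjoint T) (T x),
    dom T (adjoint T (T x)) & T (adjoint T (T x)) = adjoint T (T (T x))].
Proof.
case: qT => _ _ [dE E] Tx TTx DTTx.
have D : dom (op_comp (adjoint T) (op_pow T 2)) x by [].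
move: D; rewrite -dE => D; have /= e := E _ D; move: D => [[_ DTx] TDTx].
by split.
Qed.

(** As [T (T x) = 0] lies in the domain of [T*], quasinormality gives [T T*T x = T* T T x = 0];
    pairing with [T x] yields [T*T x = 0], hence [T x = 0]. *)
Lemma quasinormal_ker2 x : dom T x -> dom T (T x) -> T (T x) = 0 -> T x = 0.
Proof.
move=> Tx TTx TTx0.
have [D0 E0] : dom (adjoint T) 0 /\ adjoint T 0 = 0.
  by apply: ker_adjoint => // y _; rewrite linear0r.
have [|DTx TDTx e] := quasinormal_commute_rev Tx TTx; first by rewrite TTx0.
apply: ker_adjoint_comp => //; apply: inner_eq0.
by rewrite -adjointPC // e TTx0 E0 linear0r.
Qed.

(** Applied at iterates of [x], the previous lemma strips one factor [T] at a time. *)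
Lemma quasinormal_ker_pow n x : dom (op_pow T n.+1) x -> op_pow T n.+1 x = 0 ->
  dom T x /\ T x = 0.
Proof.
elim: n => [|n IHn]; first by move=> [].
move=> [[Dn Tn] TTn] e; apply: IHn => //.
exact: quasinormal_ker2 e.
Qed.

(* Take [c = T y] with [x = y + T*T y]: quasinormality exchanges [T] and [T*T]. *)
Lemma quasinormal_resolvents x : dom T x -> exists c,
  [/\ dom T c, dom (adjoint T) (T c) & c + adjoint T (T c) = T x] /\
  [/\ dom (adjoint T) c, dom T (adjoint T c) & c + T (adjoint T c) = T x].
Proof.
move=> Tx; have [y [Ty DTy e]] := adjoint_comp_surj dT cT x.
have E : adjoint T (T y) = -1 *: y + x by rewrite -e scaleN1r addKr.
have TDTy : dom T (adjoint T (T y)) by rewrite E; exact: domP.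
have [TTy DTTy c] := quasinormal_commute Ty DTy TDTy.
have eT : T y + T (adjoint T (T y)) = T x.
  by rewrite E Defs.appP // scaleN1r addrA subrr add0r.
by exists (T y); split; split => //; rewrite -c.
Qed.

Lemma quasinormal_normal :
  (forall x, dom (adjoint T) x -> adjoint T x = 0 -> dom T x /\ T x = 0) ->
  normal_op T.
Proof.
move=> kerT.
(* Here [a = A w] and [b = B w], where [w] is the common value in the last premise. *)
have resolvent_eq a b : dom T a -> dom (adjoint T) (T a) ->
    dom (adjoint T) b -> dom T (adjoint T b) ->
    a + adjoint T (T a) = b + T (adjoint T b) -> a = b.
  move=> Ta DTa Db TDb e; apply/subr0_eq.
  (* By symmetry, [inner (T x) a] and [inner (T x) b] both equal [inner c w]. *)
  have [Du u0] : dom (adjoint T) (a - b) /\ adjoint T (a - b) = 0.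
    apply: ker_adjoint => // x Tx.
    have [c [[Tc DTc e1] [Dc TDc e2]]] := quasinormal_resolvents Tx.
    rewrite [LHS]linearBr /= -{1}e1 -e2.
    by rewrite (adjoint_comp_sym dT) // (comp_adjoint_sym dT) // e subrr.
  have [Tu Tu0] := kerT _ Du u0.
  apply: inner_eq0; rewrite [LHS]linearBl /=.
  (* With [u = a - b] killed by both [T] and [T*], pairing [w] with [u] leaves only
     [inner a u = inner b u]. *)
  have : inner (a + adjoint T (T a)) (a - b) =
      inner (b + T (adjoint T b)) (a - b) by rewrite e.
  rewrite !linearDl /= -adjointPC // (adjointP dT TDb Du) u0 Tu0 !linear0r.
  rewrite !addr0 => ->; by rewrite subrr.
(* Surjectivity of the other operator yields a solution in the other domain, and [resolvent_eq]
   identifies it with [x]. *)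
have [d1 d2] : dom (op_comp T (adjoint T)) `<=` dom (op_comp (adjoint T) T) /\
    dom (op_comp (adjoint T) T) `<=` dom (op_comp T (adjoint T)).
  split=> x [/= D1 D2].
    have [a [Ta DTa e]] := adjoint_comp_surj dT cT (x + T (adjoint T x)).
    by rewrite -(resolvent_eq a x).
  have [b [Db TDb e]] := comp_adjoint_surj dT cT (x + adjoint T (T x)).
  by rewrite (resolvent_eq x b).
split=> //; split; first by apply/seteqP.
move=> x [/= Dx TDx].
have [a [Ta DTa e]] := adjoint_comp_surj dT cT (x + T (adjoint T x)).
have ax : a = x by exact: resolvent_eq.
by move: e; rewrite ax => /addrI.
Qed.

End Quasinormal.

(** * The kernel inclusion, from normality of the power *)

Theorem theorem2p10 (R : realType) (H : hilbertType R) (T : operator H)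
    (n : nat) (hn : (2 <= n)%N) (hT : quasinormal_op T)
    (hTn : normal_op (op_pow T n)) : normal_op T.
Proof.
case: n hn hTn => // n _ [dN _ [dE E]].
have [dT cT _] := hT.
apply: quasinormal_normal => // x Dx Dx0.
set N := op_pow T n.+1 in dN dE E.
(* Values of [N] lie in the range of [T], to which [x] is orthogonal. *)
have [DNx Nx0] : dom (adjoint N) x /\ adjoint N x = 0.
  by apply: ker_adjoint => // y [Dy TDy]; rewrite /= adjointP // Dx0 linear0r.
(* Membership here lets normality transfer [N N* x = 0] to [N* N x = 0], hence [N x = 0]. *)
have D : dom (op_comp N (adjoint N)) x.
  by split=> //; rewrite -/(dom N (adjoint N x)) Nx0; exact: dom0.
have e : N (adjoint N x) = adjoint N (N x) := E _ D.
have [DN1 DN2] : dom N x /\ dom (adjoint N) (N x) by move: D; rewrite dE.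
apply: (quasinormal_ker_pow hT DN1); apply: (ker_adjoint_comp dN) => //.
by rewrite -e Nx0; exact: app0.
Qed.
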